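(* Let $(\bm u_h^n,\xi_h^n,p_h^n)\in\bm V_h\times W_h\times M_h$, $0\le n\le N$, be produced by the reformulated Crank-Nicolson coupled algorithm: starting from given $(\bm u_h^0,\xi_h^0,p_h^0)\in \bm V_h\times W_h\times M_h$, for $n=1,\dots,N$, \begin{align*} &a_1(\bm u_h^n,\bm v_h)-b(\bm v_h,\xi_h^n)=(\bm f^n,\bm v_h)+\langle\bm f_1^n,\bm v_h\rangle_{\Gamma_\sigma}&&\forall\bm v_h\in\bm V_h,\\ &b(\bm u_h^n,\phi_h)+a_2(\xi_h^n,\phi_h)-c(p_h^n,\phi_h)=0&&\forall\phi_h\in W_h,\\ &a_3\Big(\tfrac{p_h^n-p_h^{n-1}}{\Delta t},\psi_h\Big)-c\Big(\psi_h,\tfrac{\xi_h^n-\xi_h^{n-1}}{\Delta t}\Big)+d\Big(\tfrac{p_h^n+p_h^{n-1}}2,\psi_h\Big)\\ &\qquad=\tfrac12(g^n+g^{n-1},\psi_h)+\tfrac12\langle g_1^n+g_1^{n-1},\psi_h\rangle_{\Gamma_q}&&\forall\psi_h\in M_h. \end{align*} Fix a time step $n\in\{1,\dots,N\}$. With $(\bm u_h^{n-1},\xi_h^{n-1},p_h^{n-1})$ from the reformulated Crank-Nicolson coupled algorithm as input, let $\{(\bm u_h^{n,i},\xi_h^{n,i},p_h^{n,i})\}_{i\ge0}$ be generated by the time-stepping iterative decoupled algorithm: $(\bm u_h^{n,0},\xi_h^{n,0},p_h^{n,0})=(\bm u_h^{n-1},\xi_h^{n-1},p_h^{n-1})$ and,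 for $i=1,2,\dots$, Step a: find $p_h^{n,i}\in M_h$ such that for all $\psi_h\in M_h$ $$a_3\Big(\tfrac{p_h^{n,i}-p_h^{n-1}}{\Delta t},\psi_h\Big)-c\Big(\psi_h,\tfrac{\xi_h^{n,i-1}-\xi_h^{n-1}}{\Delta t}\Big)+d\Big(\tfrac{p_h^{n,i}+p_h^{n-1}}2,\psi_h\Big)=\tfrac12(g^n+g^{n-1},\psi_h)+\tfrac12\langle g_1^n+g_1^{n-1},\psi_h\rangle_{\Gamma_q};$$ Step b: find $(\bm u_h^{n,i},\xi_h^{n,i})\in\bm V_h\times W_h$ such that \begin{align*} a_1(\bm u_h^{n,i},\bm v_h)-b(\bm v_h,\xi_h^{n,i})&=(\bm f^n,\bm v_h)+\langle\bm f_1^n,\bm v_h\rangle_{\Gamma_\sigma}&&\forall\bm v_h\in\bm V_h,\\ b(\bm u_h^{n,i},\phi_h)+a_2(\xi_h^{n,i},\phi_h)&=c(p_h^{n,i},\phi_h)&&\forall\phi_h\in W_h. \end{align*} Set $e_{\bm u,s}^{n,i}=\bm u_h^{n,i}-\bm u_h^n$, $e_{\xi,s}^{n,i}=\xi_h^{n,i}-\xi_h^n$, $e_{p,s}^{n,i}=p_h^{n,i}-p_h^n$. Then $(\bm u_h^{n,i},\xi_h^{n,i},p_h^{n,i})$ converges to $(\bm u_h^n,\xi_h^n,p_h^n)$ in $\bm V_h\times W_h\times M_h$ as $i\to\infty$, and for all $i\ge1$ $$\|e_{\xi,s}^{n,i}\|_{L^2(\Omega)}\le L_s\|e_{\xi,s}^{n,i-1}\|_{L^2(\Omega)},$$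 where $$L_s=\frac{1}{\left(\frac{c_0\lambda}{\alpha^2}+\frac{k_p\Delta t\,\lambda}{2C_P^2\alpha^2}+1\right)\left(C(\tilde\beta,\mu)\lambda+1\right)}$$ is a positive constant strictly smaller than $1$, and $C(\tilde\beta,\mu)>0$ is a constant depending only on $\tilde\beta$ and $\mu$. Moreover, for all $i\ge1$, $$\|e_{p,s}^{n,i}\|_{H^1(\Omega)}\lesssim\|e_{\xi,s}^{n,i-1}\|_{L^2(\Omega)},\qquad\|e_{\bm u,s}^{n,i}\|_{H^1(\Omega)}\lesssim\|e_{\xi,s}^{n,i}\|_{L^2(\Omega)}.$$
   Context: Setting: $\Omega\subset\mathbb{R}^d$ ($d=2,3$) is a bounded polygonal (polyhedral) domain with $\partial\Omega=\Gamma_{\bm u}\cup\Gamma_\sigma=\Gamma_p\cup\Gamma_q$, $\Gamma_{\bm u}\cap\Gamma_\sigma=\Gamma_p\cap\Gamma_q=\emptyset$, $|\Gamma_{\bm u}|>0$, $|\Gamma_p|>0$, and $T>0$. The parameters satisfy $\lambda,\mu,\alpha,k_p>0$ and $c_0\ge 0$. The data $\bm f,\bm f_1,g,g_1$ (body force, boundary traction on $\Gamma_\sigma$, source, flux on $\Gamma_q$) are sufficiently smooth functions of time and space. The interval $[0,T]$ is partitioned as $0=t_0<t_1<\dots<t_N=T$ with uniform step $\Delta t$; a superscript $n$ on data denotes evaluation at $t_n$. $(\cdot,\cdot)$ is the $L^2(\Omega)$ inner product and $\langle\cdot,\cdot\rangle_\Gamma$ the $L^2(\Gamma)$ inner product;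 $\varepsilon(\bm u)=\frac12[\nabla\bm u+(\nabla\bm u)^T]$. For $\Gamma\subset\partial\Omega$, $H^1_{0,\Gamma}(\Omega)=\{v\in H^1(\Omega): v=0\text{ on }\Gamma\}$, and bold letters denote $\mathbb{R}^d$-valued versions. Bilinear forms: $a_1(\bm u,\bm v)=2\mu\int_\Omega\varepsilon(\bm u):\varepsilon(\bm v)$, $b(\bm v,\phi)=\int_\Omega\phi\,\mathrm{div}\,\bm v$, $a_2(\xi,\phi)=\frac1\lambda\int_\Omega\xi\phi$, $c(p,\phi)=\frac\alpha\lambda\int_\Omega p\phi$, $a_3(p,\psi)=\left(c_0+\frac{\alpha^2}{\lambda}\right)\int_\Omega p\psi$, $d(p,\psi)=k_p\int_\Omega\nabla p\cdot\nabla\psi$. Finite element spaces on a partition $\mathcal T_h$ of $\Omega$ into triangles/tetrahedra (maximum diameter $h$), with integers $k\ge2$, $l\ge1$: $\bm V_h=\{\bm v_h\in\bm H^1_{0,\Gamma_{\bm u}}(\Omega)\cap\bm C^0(\bar\Omega):\bm v_h|_E\in\bm P_k(E)\ \forall E\in\mathcal T_h\}$, $W_h=\{\phi_h\in L^2(\Omega)\cap C^0(\bar\Omega):\phi_h|_E\in P_{k-1}(E)\ \forall E\in\mathcal T_h\}$, $M_h=\{\psi_h\in H^1_{0,\Gamma_p}(\Omega)\cap C^0(\bar\Omega):\psi_h|_E\in P_l(E)\ \forall E\in\mathcal T_h\}$. The pair $(\bm V_h,W_h)$ satisfies the discrete inf-sup condition: there is $\tilde\beta>0$ independent of $h$ with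 $\sup_{\bm v_h\in\bm V_h}\frac{b(\bm v_h,\phi_h)}{\|\bm v_h\|_{H^1(\Omega)}}\ge\tilde\beta\|\phi_h\|_{L^2(\Omega)}$ for all $\phi_h\in W_h$. Korn's inequality holds: $\|\bm v\|_{H^1(\Omega)}\le C_K\|\varepsilon(\bm v)\|_{L^2(\Omega)}$ for all $\bm v\in\bm H^1_{0,\Gamma_{\bm u}}(\Omega)$. $C_P>0$ is the Poincaré constant: $\|\psi\|_{L^2(\Omega)}\le C_P\|\nabla\psi\|_{L^2(\Omega)}$ for all $\psi\in H^1_{0,\Gamma_p}(\Omega)$. Notation: $x\lesssim y$ means $x\le Cy$ with a constant $C>0$ independent of the mesh size $h$ and of the iteration index $i$ ($C$ may depend on $\Delta t$, the physical parameters and $\Omega$). *)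

(* Defs.v *)
From HB Require Import structures.
From mathcomp Require Import all_boot all_order all_algebra.
From mathcomp Require Import all_classical all_reals all_analysis.
From mathcomp Require Import measurable_realfun.

Set Implicit Arguments.
Unset Strict Implicit.
Unset Printing Implicit Defensive.

Import Order.TTheory GRing.Theory Num.Theory.
Import numFieldNormedType.Exports.

Local Open Scope classical_set_scope.
Local Open Scope ring_scope.

(* Matrices carry the Borel sigma-algebra of their (product) topology *)
HB.instance Definition _ (R : realType) (m n : nat) :=
  Measurable.copy 'M[R]_(m, n) (g_sigma_algebraType (@open 'M[R]_(m, n))).

Section borel_row_vectors.
Context (R : realType).

Lemma open_measurable_mx m n (A : set 'M[R]_(m, n)) : open A -> measurable A.
Proof. exact: sub_sigma_algebra. Qed.

Definition rat_ball m n (p : 'M[rat]_(m, n) * nat) : set 'M[R]_(m, n) :=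
  ball (map_mx ratr p.1 : 'M[R]_(m, n)) p.2.+1%:R^-1.

Lemma open_bigcup_rat_ball m n (A : set 'M[R]_(m, n)) : open A ->
  A = \bigcup_(p in [set p | rat_ball p `<=` A]) rat_ball p.
Proof.
move=> oA; apply/seteqP; split => [x Ax|x [p /= pA] /pA //].
have /nbhs_ballP[e /= e0 xeA] := open_nbhs_nbhs (conj oA Ax).
have [N N1] : exists N, (N.+1%:R^-1 : R) < e / 2.
  have e20 : 0 < e / 2 by rewrite divr_gt0.
  have /cvgrPdist_lt/(_ _ e20)[N _ /(_ N (leqnn _))] := @cvg_harmonic R.
  by rewrite /= sub0r normrN gtr0_norm ?invr_gt0// => ?; exists N.
pose r := (N.+1%:R^-1 : R).
have r0 : 0 < r by rewrite invr_gt0.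
have q_ i j : exists q : rat, `|ratr q - x i j| < r.
  have /rat_in_itvoo[q] : x i j - r < x i j + r.
    by rewrite ltrBlDr -addrA ltrDl addr_gt0.
  rewrite in_itv/= => /andP[q1 q2]; exists q.
  by rewrite ltr_norml ltrBrDl q1 ltrBlDl q2.
pose q i j := projT1 (cid (q_ i j)).
have qP i j : `|ratr (q i j) - x i j| < r by rewrite /q; case: cid.
have qx : ball (map_mx ratr (\matrix_(i, j) q i j) : 'M[R]_(m, n)) r x.
  by split=> // i j; rewrite !mxE; exact: qP.
exists (\matrix_(i, j) q i j, N) => //= y qy; apply: xeA.
apply: (@le_ball _ _ _ (r + r)); first by rewrite (splitr e) lerD// ltW.
exact: ball_triangle (ball_sym qx) qy.
Qed.

Lemma measurable_coord n (j : 'I_n) :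
  measurable_fun setT (fun v : 'rV[R]_n => v ord0 j).
Proof.
apply: (measurability _ (RGenOpens.measurableE R)).
move=> _ [_ [a [b ->] <-]]; rewrite setTI; apply: open_measurable_mx.
apply: open_comp; last exact: interval_open.
by move=> ? _; exact: coord_continuous.
Qed.

Lemma measurable_fun_rV d (T : measurableType d) n (f : T -> 'rV[R]_n) :
  (forall j, measurable_fun setT (fun t => f t ord0 j)) ->
  measurable_fun setT f.
Proof.
move=> mf; apply: (@measurability _ _ _ _ _ _ (@open 'rV[R]_n)) => //.
move=> _ [A oA <-]; rewrite setTI.
rewrite (open_bigcup_rat_ball oA) preimage_bigcup bigcup_mkcond.
apply: countable_bigcupT_measurable; first exact: countableP.
move=> [p e]; case: ifPn => // _.
rewrite (_ : _ @^-1` _ = \bigcap_(j in [set: 'I_n])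
    ((fun t => f t ord0 j) @^-1` ball (ratr (p ord0 j) : R) e.+1%:R^-1)).
  apply: fin_bigcap_measurable => // j _; rewrite -[X in measurable X]setTI.
  by apply: mf => //; apply: open_measurable; exact: ball_open.
apply/seteqP; split => [t [e0 pe] j _|t pe].
  by have := pe ord0 j; rewrite mxE.
split=> [|i j]; first by rewrite invr_gt0.
by rewrite ord1 mxE; exact: pe.
Qed.

End borel_row_vectors.

Section row_vector_split.
Context (R : realType) (n : nat).
Implicit Types (z : measurableTypeR R * 'rV[R]_n).

Definition consmx z : 'rV[R]_n.+1 := row_mx (z.1%:M : 'rV[R]_1) z.2.

Definition unconsmx (v : 'rV[R]_(1 + n)) : measurableTypeR R * 'rV[R]_n :=
  (v ord0 ord0, rsubmx v).

Lemma consmx0 z : consmx z ord0 ord0 = z.1.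
Proof.
have := row_mxEl (z.1%:M : 'M[R]_1) z.2 ord0 ord0.
rewrite [X in _ = X -> _]mxE mulr1n => <-.
by congr (row_mx _ _ _ _); apply/val_inj.
Qed.

Lemma consmxS z (j : 'I_n) : consmx z ord0 (rshift 1 j) = z.2 ord0 j.
Proof. exact: row_mxEr. Qed.

Lemma consmxK : cancel consmx unconsmx.
Proof.
move=> [x v]; rewrite /unconsmx consmx0 (_ : rsubmx _ = v)//.
exact: row_mxKr.
Qed.

Lemma measurable_consmx : measurable_fun setT consmx.
Proof.
apply: measurable_fun_rV => j.
case: (split_ordP (j : 'I_(1 + n))) => k ->.
  have -> : lshift n k = ord0 :> 'I_n.+1 by rewrite ord1; apply/val_inj.
  rewrite (funext consmx0); exact: measurable_fst.
rewrite (_ : (fun z => _) = (fun v : 'rV[R]_n => v ord0 k) \o snd).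
  exact: measurableT_comp (measurable_coord k) measurable_snd.
by apply/funext => z; rewrite consmxS.
Qed.

Lemma measurable_unconsmx : measurable_fun setT unconsmx.
Proof.
apply/measurable_fun_pairP; split; first exact: measurable_coord.
apply: measurable_fun_rV => j /=.
rewrite (_ : (fun v => _) = fun v : 'rV[R]_n.+1 => v ord0 (rshift 1 j)).
  exact: measurable_coord.
by apply/funext => v; rewrite mxE.
Qed.

End row_vector_split.

HB.instance Definition _ (R : realType) n :=
  isMeasurableFun.Build _ _ _ _ (@consmx R n) (@measurable_consmx R n).
Section lebesgue_rV.
Context (R : realType).

Section leb_cons.
Context n (mu : {sigma_finite_measure set 'rV[R]_n -> \bar R}).

Definition leb_cons : set 'rV[R]_n.+1 -> \bar R :=
  pushforward ((@lebesgue_measure R) \x mu)%E (@consmx R n).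

Let leb_cons0 : leb_cons set0 = 0.
Proof. exact: measure0. Qed.

Let leb_cons_ge0 A : (0 <= leb_cons A)%E.
Proof. exact: measure_ge0. Qed.

Let leb_cons_sigma_additive : semi_sigma_additive leb_cons.
Proof. exact: measure_semi_sigma_additive. Qed.

HB.instance Definition _ := isMeasure.Build _ _ _ leb_cons
  leb_cons0 leb_cons_ge0 leb_cons_sigma_additive.

Let leb_cons_sigma_finite : sigma_finite setT leb_cons.
Proof.
have /sigma_finiteP[F [TF ndF Foo]] := sigma_finiteT (@lebesgue_measure R).
have /sigma_finiteP[G [TG ndG Goo]] := sigma_finiteT mu.
exists (fun k => @unconsmx R n @^-1` (F k `*` G k)).
  rewrite -preimage_bigcup (_ : \bigcup_k (F k `*` G k) = setT).
    by rewrite preimage_setT.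
  apply/seteqP; split => // -[x y] _.
  have [[i _ Fx] [j _ Gy]] : (\bigcup_k F k) x /\ (\bigcup_k G k) y.
    by rewrite -TF -TG.
  exists (maxn i j) => //; split.
  - by move: x Fx; exact/subsetPset/ndF/leq_maxl.
  - by move: y Gy; exact/subsetPset/ndG/leq_maxr.
move=> k; have [mF Fk] := Foo k; have [mG Gk] := Goo k; split.
  rewrite -[X in measurable X]setTI; apply: measurable_unconsmx => //.
  exact: measurableX.
rewrite /leb_cons /pushforward (_ : _ @^-1` _ = F k `*` G k).
  by rewrite product_measure1E// lte_mul_pinfty// ge0_fin_numE.
rewrite -comp_preimage (_ : _ \o _ = id) ?preimage_id//.
by apply/funext => z; exact: consmxK.
Qed.

HB.instance Definition _ := Measure_isSigmaFinite.Build _ _ _ leb_cons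
  leb_cons_sigma_finite.

End leb_cons.


(* Lebesgue measure on R^n, as the n-fold product of Lebesgue measure on R *)
Fixpoint leb n : {sigma_finite_measure set 'rV[R]_n -> \bar R} :=
  match n with
  | 0 => \d_ (0 : 'rV[R]_0)
  | m.+1 => @leb_cons m (@leb m)
  end.

End lebesgue_rV.

Section simplices.
Context (R : realType) (m n : nat).
(* The rows of V are the m + 1 vertices of an m-simplex in R^n *)
Implicit Types (V : 'M[R]_(m.+1, n)) (y : 'rV[R]_m).

Definition edge_mx V : 'M[R]_(m, n) :=
  \matrix_(i < m) (row (lift ord0 i) V - row ord0 V).

Definition simplex_map V y : 'rV[R]_n := row ord0 V + y *m edge_mx V.

Definition std_simplex : set 'rV[R]_m :=
  [set y | (forall i, 0 <= y ord0 i) /\ \sum_i y ord0 i <= 1].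

Definition std_open_simplex : set 'rV[R]_m :=
  [set y | (forall i, 0 < y ord0 i) /\ \sum_i y ord0 i < 1].

Definition simplex V : set 'rV[R]_n := simplex_map V @` std_simplex.

Definition open_simplex V : set 'rV[R]_n := simplex_map V @` std_open_simplex.

Lemma measurable_std_simplex : measurable std_simplex.
Proof.
rewrite (_ : std_simplex = \bigcap_(i in [set: 'I_m])
    ((fun y : 'rV[R]_m => y ord0 i) @^-1` `[0, +oo[%classic) `&`
  (fun y : 'rV[R]_m => \sum_i y ord0 i) @^-1` `]-oo, 1]%classic).
  apply: measurableI.
    apply: fin_bigcap_measurable => // i _; rewrite -[X in measurable X]setTI.
    exact: measurable_coord.
  rewrite -[X in measurable X]setTI.
  have : measurable_fun setT (fun y : 'rV[R]_m => \sum_i y ord0 i).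
    by apply: measurable_sum => i; exact: measurable_coord.
  by apply.
apply/seteqP; split => y [y0 y1]; split => //=.
- by move=> i _ /=; rewrite in_itv/= andbT.
- by move=> i; have := y0 i I; rewrite /= in_itv/= andbT.
Qed.

Lemma measurable_simplex_map V : measurable_fun setT (simplex_map V).
Proof.
apply: measurable_fun_rV => j.
rewrite (_ : (fun y => _) = fun y : 'rV[R]_m =>
    V ord0 j + \sum_i y ord0 i * edge_mx V i j).
  apply: measurable_funD => //; apply: measurable_sum => i.
  by apply: measurable_funM => //; exact: measurable_coord.
by apply/funext => y; rewrite !mxE.
Qed.

HB.instance Definition _ V :=
  isMeasurableFun.Build _ _ _ _ (simplex_map V) (measurable_simplex_map V).

Definition std_simplex_image V : set 'rV[R]_n -> \bar R :=
  pushforward (mrestr (leb R m) measurable_std_simplex) (simplex_map V).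

Let std_simplex_image0 V : std_simplex_image V set0 = 0.
Proof. exact: measure0. Qed.

Let std_simplex_image_ge0 V A : (0 <= std_simplex_image V A)%E.
Proof. exact: measure_ge0. Qed.

Let std_simplex_image_sigma_additive V :
  semi_sigma_additive (std_simplex_image V).
Proof. exact: measure_semi_sigma_additive. Qed.

HB.instance Definition _ V := isMeasure.Build _ _ _ (std_simplex_image V)
  (std_simplex_image0 V) (@std_simplex_image_ge0 V)
  (@std_simplex_image_sigma_additive V).

(* m-dimensional area on the simplex V, scaled by the square root of the Gram
   determinant of the affine parametrization by the standard simplex *)
Definition simplex_measure V : {measure set 'rV[R]_n -> \bar R} :=
  mscale (Num.sqrt (\det (edge_mx V *m (edge_mx V)^T)))%:nng
    (std_simplex_image V).

(* The simplices of F divide A up to overlaps of their boundaries; faces need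
   not match *)
Definition simplicial_partition (A : set 'rV[R]_n) (F : seq 'M[R]_(m.+1, n)) :=
  [/\ forall V, V \in F -> row_free (edge_mx V),
      A = \bigcup_(V in [set` F]) simplex V &
      forall i j, (i < j < size F)%N ->
        open_simplex (nth 0 F i) `&` open_simplex (nth 0 F j) = set0].

Definition surface_measure (F : seq 'M[R]_(m.+1, n)) :
    {measure set 'rV[R]_n -> \bar R} :=
  msum (fun i => simplex_measure (nth 0 F i)) (size F).

End simplices.

Section domains.
Context (R : realType) (d : nat).
Implicit Types (Om : set 'rV[R]_d).

(* [interior (closure Om) = Om] excludes slits: Om lies on one side of each
   boundary facet, as needed for traces to be single-valued *)
Definition polyhedral_domain Om (F : seq 'M[R]_(d.-1.+1, d)) :=
  [/\ open Om, connected Om, Om !=set0, bounded_set Om &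
      interior (closure Om) = Om /\
      simplicial_partition (closure Om `\` Om) F].

Definition boundary_split (Om G1 G2 : set 'rV[R]_d) :=
  [/\ measurable G1, measurable G2, G1 `&` G2 = set0 &
      closure Om `\` Om = G1 `|` G2].

End domains.

Section sobolev.
Context (R : realType) (d : nat).
Local Notation E := 'rV[R]_d.
Implicit Types (Om D G : set E) (phi w : E -> R).

Section L2.
Context (mu : {measure set E -> \bar R}).

Definition L2 D (f : E -> R) : Prop := f \_ D \in Lfun mu 2%:E.

Definition ip D (f g : E -> R) : R := \int[mu]_(x in D) (f x * g x).

Definition L2norm D f := Num.sqrt (ip D f f).

End L2.

Fixpoint is_Ck k phi : Prop :=
  continuous phi /\
  if k is k'.+1 then
    forall j : 'I_d, (forall x, derivable phi x (delta_mx 0 j)) /\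
                     is_Ck k' ('D_(delta_mx 0 j) phi)
  else True.

Definition smooth phi := forall k, is_Ck k phi.

Definition test_fun Om phi :=
  smooth phi /\
  exists K : set E,
    [/\ compact K, K `<=` Om & forall x, ~ K x -> phi x = 0].

(* An element of H^1 is carried together with (a representative of) its weak
   gradient, which is unique almost everywhere *)
Definition sob : Type := ((E -> R^o) * ('I_d -> E -> R^o))%type.

Definition fval (v : sob) : E -> R := v.1.
Definition grad (v : sob) : 'I_d -> E -> R := v.2.

Definition H1 Om (v : sob) :=
  [/\ L2 (leb R d) Om (fval v), forall j, L2 (leb R d) Om (grad v j) &
      forall phi, test_fun Om phi -> forall j,
        ip (leb R d) Om (fval v) ('D_(delta_mx 0 j) phi) =
        - ip (leb R d) Om (grad v j) phi].

Definition gradnorm Om (v : sob) :=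
  Num.sqrt (\sum_j ip (leb R d) Om (grad v j) (grad v j)).

Definition H1norm Om (v : sob) :=
  Num.sqrt (L2norm (leb R d) Om (fval v) ^+ 2 + gradnorm Om v ^+ 2).

Definition smooth_sob phi : sob :=
  (phi, fun j : 'I_d => 'D_(delta_mx 0 j) phi).

(* The trace operator H^1(Om) -> L^2(boundary), as the closure of the
   restriction of smooth functions *)
Definition is_trace (sigma : {measure set E -> \bar R}) Om (v : sob) w :=
  L2 sigma (closure Om `\` Om) w /\
  exists phi : nat -> E -> R,
    [/\ forall n, smooth (phi n),
        (fun n => H1norm Om (smooth_sob (phi n) - v)) @ \oo --> (0 : R) &
        (fun n => L2norm sigma (closure Om `\` Om) (phi n \- w)) @ \oo
          --> (0 : R)].

Definition H1_0 sigma Om G (v : sob) :=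
  H1 Om v /\
  exists w, is_trace sigma Om v w /\ {ae sigma, forall x, G x -> w x = 0}.

Definition vsob : Type := 'I_d -> sob.

Definition vH1_0 sigma Om G (v : vsob) := forall j, H1_0 sigma Om G (v j).

Definition vH1norm Om (v : vsob) := Num.sqrt (\sum_j H1norm Om (v j) ^+ 2).

Definition strain (v : vsob) i j : E -> R :=
  fun x => (grad (v i) j x + grad (v j) i x) / 2.

Definition divergence (v : vsob) : E -> R := fun x => \sum_i grad (v i) i x.

Definition strain_ip Om (u v : vsob) :=
  \int[leb R d]_(x in Om) (\sum_i \sum_j strain u i j x * strain v i j x).

Definition strain_norm Om v := Num.sqrt (strain_ip Om v v).

(* The L^2 inner product of vector fields *)
Definition vip (mu : {measure set E -> \bar R}) D (f v : 'I_d -> E -> R) :=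
  \sum_j ip mu D (f j) (v j).

End sobolev.

Arguments sob : clear implicits.
Arguments vsob : clear implicits.

Section bilinear_forms.
Context (R : realType) (d : nat) (Om : set 'rV[R]_d).
Local Notation E := 'rV[R]_d.
Implicit Types (u v : vsob R d) (p psi : sob R d) (xi phi q : E -> R).

Definition form_a1 mu u v : R := 2 * mu * strain_ip Om u v.

Definition form_b v phi := ip (leb R d) Om phi (divergence v).

Definition form_a2 lam xi phi := lam^-1 * ip (leb R d) Om xi phi.

Definition form_c lam alpha q phi := alpha / lam * ip (leb R d) Om q phi.

Definition form_a3 lam alpha c0 q phi :=
  (c0 + alpha ^+ 2 / lam) * ip (leb R d) Om q phi.

Definition form_d kp p psi : R :=
  kp * \int[leb R d]_(x in Om) (\sum_j grad p j x * grad psi j x).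

End bilinear_forms.

Section finite_elements.
Context (R : realType) (d : nat) (sigma : {measure set 'rV[R]_d -> \bar R}).
Context (Om : set 'rV[R]_d) (Th : seq 'M[R]_(d.+1, d)).

(* f coincides on A with a polynomial of total degree at most k *)
Definition poly_on k (A : set 'rV[R]_d) (f : 'rV[R]_d -> R) :=
  exists c : {ffun 'I_d -> 'I_k.+1} -> R, forall x, A x ->
    f x = \sum_(a : {ffun 'I_d -> 'I_k.+1} | (\sum_j a j <= k)%N)
            c a * \prod_j x ord0 j ^+ a j.

Definition cont_pw_poly k (f : 'rV[R]_d -> R) :=
  {within closure Om, continuous f} /\
  forall V, V \in Th -> poly_on k (simplex V) f.

Definition Vh (Gu : set 'rV[R]_d) k : set (vsob R d) :=
  [set v | vH1_0 sigma Om Gu v /\ forall j, cont_pw_poly k (fval (v j))].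

Definition Wh k : set ('rV[R]_d -> R) :=
  [set phi | L2 (leb R d) Om phi /\ cont_pw_poly k.-1 phi].

Definition Mh (Gp : set 'rV[R]_d) l : set (sob R d) :=
  [set psi | H1_0 sigma Om Gp psi /\ cont_pw_poly l (fval psi)].

End finite_elements.

Definition inf_sup (R : realType) d (Om : set 'rV[R]_d) (V : set (vsob R d))
    (W : set ('rV[R]_d -> R)) (beta : R) :=
  forall phi, W phi ->
    ((beta * L2norm (leb R d) Om phi)%:E <=
     ereal_sup [set (form_b Om v phi / vH1norm Om v)%:E |
                v in V `&` [set v | (vH1norm Om v != 0)%R]])%E.

Definition poincare (R : realType) d sigma (Om G : set 'rV[R]_d) (CP : R) :=
  forall psi : sob R d, H1_0 sigma Om G psi ->
    L2norm (leb R d) Om (fval psi) <= CP * gradnorm Om psi.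

Definition korn (R : realType) d sigma (Om G : set 'rV[R]_d) (CK : R) :=
  forall v : vsob R d, vH1_0 sigma Om G v ->
    vH1norm Om v <= CK * strain_norm Om v.

Definition contraction_factor (R : realType) (lam alpha kp c0 dt CP C : R) : R :=
  1 / ((c0 * lam / alpha ^+ 2
        + kp * dt * lam / (2 * CP ^+ 2 * alpha ^+ 2) + 1) * (C * lam + 1)).

(* Main.v *)
Require Import Defs.
From HB Require Import structures.
From mathcomp Require Import all_boot all_order all_algebra.
From mathcomp Require Import all_classical all_reals all_analysis.
From mathcomp Require Import measurable_realfun ring lra.

Set Implicit Arguments.
Unset Strict Implicit.
Unset Printing Implicit Defensive.

Import Order.TTheory GRing.Theory Num.Theory.
Import numFieldNormedType.Exports.

Local Open Scope classical_set_scope.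
Local Open Scope ring_scope.

(** Subtracting the equations of the coupled scheme from those of the iteration
removes the data, and what remains is a homogeneous system for the errors
[eu], [exi], [ep]; write [exi'] for the total pressure error of the previous
iterate, which is the only quantity that enters the new iterate.

Testing the flow equation with [ep] gives
  (c0 + alpha^2/lam)/dt |ep|^2 + kp/2 |grad ep|^2 = alpha/(lam dt) (ep, exi').
Bounding the gradient below by Poincare's inequality and cancelling one factor
[|ep|] yields the first factor of the contraction ([pressure_estimate]):
  (c0 lam/alpha^2 + kp dt lam/(2 CP^2 alpha^2) + 1) alpha |ep| <= |exi'|.

Testing the momentum equation with [eu] and the total pressure equation with
[exi] gives
  2 mu |strain eu|^2 + |exi|^2/lam = alpha/lam (ep, exi).
The elastic energy on the left controls [exi]: by the momentum equation
[b(v, exi) = a1(eu, v) <= 2 mu |strain eu| |v|_H1], so the inf-sup condition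
gives [beta |exi| <= 2 mu |strain eu|] ([inf_sup_strain]).  Hence the second
factor ([total_pressure_estimate]), with [C(beta, mu) = beta^2/(2 mu)]:
  (beta^2/(2 mu) lam + 1) |exi| <= alpha |ep|.
The product of both is the contraction.  The bound on [ep] in H^1 comes from
the same flow identity, now keeping the gradient term, and the bound on [eu]
from Korn's inequality; convergence of all three errors follows.

Testing with the errors requires that they lie in the discrete spaces, and all
the bilinear forms are integrals that only behave bilinearly on square
integrable functions.  For the first point, the delicate condition is the zero
trace: a difference of traces is a trace because the restrictions of smooth
functions to the bounded domain and to its boundary are square integrable, the
latter because the boundary has finite surface measure ([H1_0B]).  For the
second, every form is built from positive semidefinite forms on a subspace
([semi_inner]), for which bilinearity, Cauchy-Schwarz and the triangle
inequality are proved once. *)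

(** * Positive semidefinite forms on a subspace *)

Section semi_inner_products.
Variable R : realType.

(** The form is required to be bilinear only on [S]: an integral of a product is
additive only where the products are integrable.  Membership in [S] is a
predicate rather than a type because the errors are built by subtraction in the
ambient module. *)
Record semi_inner (U : lmodType R) (S : set U) (B : U -> U -> R) : Prop := {
  semi_inner_lin : forall a x y, S x -> S y -> S (a *: x + y);
  semi_innerPl : forall a x y z, S x -> S y -> S z ->
    B (a *: x + y) z = a * B x z + B y z;
  semi_innerC : forall x y, B x y = B y x;
  semi_inner_ge0 : forall x, 0 <= B x x }.

Section theory.
Context (U : lmodType R) (S : set U) (B : U -> U -> R).
Hypothesis SB : semi_inner S B.
Implicit Types x y z : U.

Lemma semi_inner_quad a x y : S x -> S y ->
  B (a *: x + y) (a *: x + y) = a ^+ 2 * B x x + 2 * a * B x y + B y y.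
Proof.
move=> Sx Sy; have Sz := semi_inner_lin SB a Sx Sy.
rewrite (semi_innerPl SB)// [B x _](semi_innerC SB) [B y _](semi_innerC SB).
rewrite !(semi_innerPl SB)// [B y x](semi_innerC SB); ring.
Qed.

Lemma semi_inner_sub_closed x y : S x -> S y -> S (x - y).
Proof.
by move=> Sx Sy; rewrite addrC -scaleN1r; exact: (semi_inner_lin SB).
Qed.

Lemma semi_innerBl x y z : S x -> S y -> S z -> B (x - y) z = B x z - B y z.
Proof.
move=> Sx Sy Sz; rewrite addrC -scaleN1r (semi_innerPl SB)// mulN1r.
by rewrite addrC.
Qed.

Lemma semi_innerBr x y z : S x -> S y -> S z -> B z (x - y) = B z x - B z y.
Proof. by move=> *; rewrite !(semi_innerC SB z) semi_innerBl. Qed.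

Lemma semi_innerZl a x y : S x -> S y -> B (a *: x) y = a * B x y.
Proof.
move=> Sx Sy; have S0 : S 0 by rewrite -(subrr x); exact: semi_inner_sub_closed.
rewrite -[a *: x]addr0 (semi_innerPl SB)// -(subrr x) semi_innerBl//.
by rewrite subrr addr0.
Qed.

Lemma semi_innerD_le x y : S x -> S y ->
  B (x + y) (x + y) <= 2 * B x x + 2 * B y y.
Proof.
move=> Sx Sy; have := semi_inner_ge0 SB (-1 *: x + y).
have -> : x + y = 1 *: x + y by rewrite scale1r.
by rewrite !semi_inner_quad//; lra.
Qed.

(** The quadratic [a |-> B (a x + y) (a x + y)] is nonnegative.  If [B x x] is
positive, its value at the minimizer [- B x y / B x x] is the claim; otherwise
it is affine, which forces [B x y = 0]. *)
Lemma cauchy_schwarz x y : S x -> S y ->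
  `|B x y| <= Num.sqrt (B x x) * Num.sqrt (B y y).
Proof.
move=> Sx Sy; rewrite -sqrtrM ?(semi_inner_ge0 SB)// -sqrtr_sqr ler_wsqrtr//.
have q a : 0 <= a ^+ 2 * B x x + 2 * a * B x y + B y y.
  by rewrite -semi_inner_quad//; exact: semi_inner_ge0 SB _.
have := semi_inner_ge0 SB x; rewrite le_eqVlt => /predU1P[xx0|xx0].
  have [->|b0] := eqVneq (B x y) 0; first by rewrite -xx0 expr0n/= mul0r.
  (* the affine function takes the value -1 at this point *)
  have := q (- (B y y + 1) / (2 * B x y)); rewrite -xx0 mulr0 add0r.
  rewrite (_ : 2 * _ * _ = - (B y y + 1)); first by move=> ?; exfalso; lra.
  by field.
have := q (- B x y / B x x).
rewrite (_ : _ + B y y = (B x x * B y y - B x y ^+ 2) / B x x); last first.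
  by field; rewrite gt_eqF.
by rewrite pmulr_lge0 ?invr_gt0// subr_ge0.
Qed.

Lemma semi_norm_triangle x y : S x -> S y ->
  Num.sqrt (B (x - y) (x - y)) <= Num.sqrt (B x x) + Num.sqrt (B y y).
Proof.
move=> Sx Sy; rewrite -[leRHS]ger0_norm ?addr_ge0 ?sqrtr_ge0//.
rewrite -sqrtr_sqr ler_wsqrtr// sqrrD !sqr_sqrtr ?(semi_inner_ge0 SB)//.
have -> : x - y = (-1) *: y + x by rewrite scaleN1r addrC.
rewrite semi_inner_quad// sqrrN expr1n mul1r mulrN1.
have := cauchy_schwarz Sy Sx; rewrite ler_norml => /andP[+ _]; lra.
Qed.

End theory.

(** All the forms below arise from the L^2 inner product in this way: the H^1
product from the value and the partial derivatives, the elastic form from the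
entries of the strain, the diffusion form from the gradient. *)
Lemma semi_inner_pullback (I : finType) (U W : lmodType R) (S : set U)
    (B : U -> U -> R) (L : I -> W -> U) :
  semi_inner S B ->
  (forall i a x y, L i (a *: x + y) = a *: L i x + L i y) ->
  semi_inner [set x | forall i, S (L i x)]
    (fun x y => \sum_i B (L i x) (L i y)).
Proof.
move=> SB lL; split=> [a x y Sx Sy i|a x y z Sx Sy Sz|x y|x].
- by rewrite lL; exact: semi_inner_lin SB _ _ _ _ _.
- rewrite mulr_sumr -big_split/=; apply: eq_bigr => i _.
  by rewrite lL (semi_innerPl SB).
- by apply: eq_bigr => i _; rewrite (semi_innerC SB).
- by apply: sumr_ge0 => i _; exact: semi_inner_ge0 SB _.
Qed.

End semi_inner_products.

(** * The L2 inner product *)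

Section L2_space.
Context (R : realType) (d : nat) (mu : {measure set 'rV[R]_d -> \bar R}).
Context (D : set 'rV[R]_d).
Local Notation E := 'rV[R]_d.
Implicit Types f g h : E -> R^o.

Lemma L2_lin a f g : L2 mu D f -> L2 mu D g -> L2 mu D (a *: f + g).
Proof.
rewrite /L2 => fD gD.
rewrite (_ : _ \_ D = a *: ((f \_ D) : E -> R^o) + ((g \_ D) : E -> R^o)).
  exact: (Lfun_submod_closed mu (lee1n 2)).2.
by apply/funext => x; rewrite !fctE /patch; case: ifP; rewrite // scaler0 addr0.
Qed.

Hypothesis mD : measurable D.

Lemma integrable_mul_L2 f g : L2 mu D f -> L2 mu D g ->
  mu.-integrable D (EFin \o (fun x => f x * g x)).
Proof.
move=> fD gD; apply/integrable_mkcond => //.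
have /Lfun1_integrable := Lfun2_mul_Lfun1 fD gD.
congr (_.-integrable _ _); apply/funext => x; rewrite /= /patch.
by case: ifP => // _; rewrite mulr0.
Qed.

Lemma semi_inner_L2 : @semi_inner R (E -> R^o) (L2 mu D) (ip mu D).
Proof.
split=> [|a f g h fD gD hD|f g|f]; first exact: L2_lin.
- rewrite /ip (_ : (fun x => _) = fun x => a * (f x * h x) + g x * h x).
    rewrite RintegralD//; last exact: integrable_mul_L2.
      by rewrite RintegralZl//; exact: integrable_mul_L2.
    rewrite (_ : EFin \o _ = fun x => (a%:E * (f x * h x)%R%:E)%E).
      by apply: integrableZl => //; exact: integrable_mul_L2.
    by apply/funext.
  by apply/funext => x; rewrite mulrDl -scalerAl.
- by apply: eq_Rintegral => x _; rewrite mulrC.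
- by apply: Rintegral_ge0 => x _; rewrite -expr2 sqr_ge0.
Qed.

Lemma Rintegral_sum_L2 (I : finType) (f g : I -> E -> R^o) :
  (forall i, L2 mu D (f i)) -> (forall i, L2 mu D (g i)) ->
  \int[mu]_(x in D) (\sum_i f i x * g i x) = \sum_i ip mu D (f i) (g i).
Proof.
move=> fD gD; have iD i := integrable_mul_L2 (fD i) (gD i).
rewrite /ip /Rintegral; under eq_integral do rewrite -sumEFin.
rewrite (integral_sum mD iD) -sum_fine// => i _.
exact: integrable_fin_num.
Qed.

End L2_space.

(** * Finite measures and bounded functions *)

Section finiteness.
Variable R : realType.

(** Boxes rather than balls: [leb] is an iterated product measure, so a box is
measured by induction on the dimension. *)
Definition box n (M : R) : set 'rV[R]_n :=
  [set v | forall j, `[- M, M]%classic (v ord0 j)].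

Lemma measurable_box n M : measurable (@box n M).
Proof.
rewrite (_ : @box n M = \bigcap_(i in [set: 'I_n])
    ((fun y : 'rV[R]_n => y ord0 i) @^-1` `[- M, M]%classic)).
  apply: fin_bigcap_measurable => // i _; rewrite -[X in measurable X]setTI.
  exact: measurable_coord.
by apply/seteqP; split => v vM; [move=> j _; exact: vM|move=> j; exact: vM].
Qed.

Lemma compact_box n M : compact (@box n M).
Proof.
apply: (@rV_compact R n (fun=> `[- M, M]%classic)) => j.
exact: segment_compact.
Qed.

Lemma leb_box n M : (leb R n (@box n M) < +oo)%E.
Proof.
elim: n => [|n IH] /=; first by rewrite /dirac indicE ltry.
rewrite /leb_cons /pushforward.
rewrite (_ : _ @^-1` _ = `[- M, M]%classic `*` @box n M).
  rewrite product_measure1E//=; last exact: measurable_box.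
  rewrite lte_mul_pinfty//.
    by rewrite lebesgue_measure_itv/=; case: ifP.
apply/seteqP; split => [[x v] xv|[x v] [/= xM vM]].
  split=> [|j] /=; first by have := xv ord0; rewrite /= consmx0.
  by have := xv (rshift 1 j); rewrite consmxS.
move=> j; case: (split_ordP (j : 'I_(1 + n))) => k ->.
  have -> : lshift n k = ord0 :> 'I_n.+1 by rewrite ord1; apply/val_inj.
  by rewrite consmx0.
by rewrite consmxS; exact: vM.
Qed.

Lemma bounded_sub_box n (A : set 'rV[R]_n) :
  bounded_set A -> exists M, A `<=` @box n M.
Proof.
move=> [M [_ AM]]; exists (M + 1) => v Av j; rewrite /= in_itv/= -ler_norml.
apply: (@le_trans _ _ `|v|); last by apply: AM => //; rewrite ltrDl.
by rewrite [leRHS]mx_normrE; exact: (le_bigmax _ (fun i => `|v i.1 i.2|) (ord0, j)).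
Qed.

Lemma closure_sub_box n (A : set 'rV[R]_n) M :
  A `<=` @box n M -> closure A `<=` @box n M.
Proof.
move=> AM; have cb : closed (@box n M).
  by apply: compact_closed; [exact: norm_hausdorff|exact: compact_box].
by move=> x /(closure_subset AM); rewrite -(closure_id _).1.
Qed.

Lemma leb_sub_box n (A : set 'rV[R]_n) M :
  measurable A -> A `<=` @box n M -> (leb R n A < +oo)%E.
Proof.
move=> mA AM; apply: le_lt_trans (leb_box n M).
by apply: le_measure; rewrite ?inE//; exact: measurable_box.
Qed.

Lemma std_simplex_sub_box m : @std_simplex R m `<=` @box m 1.
Proof.
move=> v [v0 v1] j; rewrite /= in_itv/=; apply/andP; split.
  by apply: le_trans (v0 j); rewrite lerN10.
by apply: le_trans v1; rewrite (bigD1 j)//= lerDl sumr_ge0.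
Qed.

(** Each facet carries a multiple of the image of Lebesgue measure on the
standard simplex, which lies in a box. *)
Lemma surface_measure_fin m n (F : seq 'M[R]_(m.+1, n)) (A : set 'rV[R]_n) :
  measurable A -> (surface_measure F A < +oo)%E.
Proof.
move=> mA; rewrite /surface_measure /= /msum; apply: lte_sum_pinfty => i _.
rewrite /simplex_measure /= /mscale /= lte_mul_pinfty//.
rewrite /std_simplex_image /pushforward /mrestr.
apply: (@leb_sub_box _ _ 1); last first.
  by move=> x [_ /std_simplex_sub_box].
apply: measurableI; last exact: measurable_std_simplex.
rewrite -[X in measurable X]setTI; exact: measurable_simplex_map.
Qed.

End finiteness.

Section L2_bounded.
Context (R : realType) (d : nat) (mu : {measure set 'rV[R]_d -> \bar R}).

Lemma continuous_measurable (f : 'rV[R]_d -> R) :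
  continuous f -> measurable_fun setT f.
Proof.
move=> /continuousP cf; apply: (measurability _ (RGenOpens.measurableE R)).
move=> _ [_ [a [b ->] <-]]; rewrite setTI; apply: open_measurable_mx.
exact/cf/interval_open.
Qed.

Lemma L2_bounded D (f : 'rV[R]_d -> R) M :
  measurable D -> (mu D < +oo)%E -> measurable_fun setT f ->
  (forall x, D x -> `|f x| <= M) -> L2 mu D f.
Proof.
move=> mD muD mf fM; have mfD : measurable_fun setT (f \_ D).
  by apply/(measurable_restrictT f mD)/measurable_funTS.
rewrite /L2 inE; apply/andP; split; first by rewrite inE.
rewrite inE /= /finite_norm unlock /Lnorm; apply: poweR_lty.
under eq_integral do rewrite abse_EFin poweR_EFin powR_mulrn//.
rewrite (@le_lt_trans _ _ (\int[mu]_(x in D) (M ^+ 2)%:E)%E)//.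
  rewrite [leRHS]integral_mkcond; apply: ge0_le_integral => //.
  - by apply/measurable_EFinP/measurable_funX/measurableT_comp.
  - by apply/(measurable_restrictT _ mD).
  - move=> x _; rewrite /patch; case: ifPn => [/set_mem Dx|_].
      by rewrite lee_fin lerXn2r ?nnegrE// ?(le_trans _ (fM x Dx))// fM.
    by rewrite normr0 expr0n.
by rewrite integral_cst// lte_mul_pinfty// lee_fin sqr_ge0.
Qed.

Lemma continuous_bounded_box M (f : 'rV[R]_d -> R^o) : continuous f ->
  exists K, forall x, @box R d M x -> `|f x| <= K.
Proof.
move=> cf; have : compact (f @` @box R d M).
  by apply: continuous_compact (@compact_box _ _ _); exact: continuous_subspaceT.
move=> /compact_bounded[K [_ fK]]; exists (K + 1) => x xM.
by apply: (fK (K + 1)); [rewrite ltrDl|exists x].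
Qed.

End L2_bounded.

(** * The Sobolev space and zero traces *)

Section sobolev_space.
Context (R : realType) (d : nat) (Om : set 'rV[R]_d).
Local Notation E := 'rV[R]_d.
Implicit Types (v w : sob R d) (phi psi : E -> R).
Hypothesis mOm : measurable Om.

(** The value (index 0) and the partial derivatives (the other indices) as a
single family of linear maps, so that the H^1 product is one pullback. *)
Definition H1_part (i : 'I_d.+1) v : E -> R^o :=
  oapp (grad v) (fval v) (unlift ord0 i).

Definition H1_ip v w := \sum_i ip (leb R d) Om (H1_part i v) (H1_part i w).

Lemma H1_part_lin i a v w :
  H1_part i (a *: v + w) = a *: H1_part i v + H1_part i w.
Proof. by rewrite /H1_part; case: unlift. Qed.

Lemma semi_inner_H1 :
  @semi_inner R (sob R d) [set v | forall i, L2 (leb R d) Om (H1_part i v)] H1_ip.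
Proof. exact: semi_inner_pullback (semi_inner_L2 _ mOm) H1_part_lin. Qed.

Lemma H1_partP v : (forall i, L2 (leb R d) Om (H1_part i v)) <->
  L2 (leb R d) Om (fval v) /\ forall j, L2 (leb R d) Om (grad v j).
Proof.
split=> [h|[h0 h] i]; last by rewrite /H1_part; case: unlift.
split=> [|j]; first by have := h ord0; rewrite /H1_part unlift_none.
by have := h (lift ord0 j); rewrite /H1_part liftK.
Qed.

Lemma ip_ge0 D f : 0 <= ip (leb R d) D f f.
Proof. by apply: Rintegral_ge0 => x _; rewrite -expr2 sqr_ge0. Qed.

Lemma gradnorm_sqr v :
  gradnorm Om v ^+ 2 = \sum_j ip (leb R d) Om (grad v j) (grad v j).
Proof. by rewrite sqr_sqrtr// sumr_ge0// => j _; exact: ip_ge0. Qed.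

Lemma L2norm_sqr D f : L2norm (leb R d) D f ^+ 2 = ip (leb R d) D f f.
Proof. by rewrite sqr_sqrtr// ip_ge0. Qed.

Lemma H1normE v : H1norm Om v = Num.sqrt (H1_ip v v).
Proof.
rewrite /H1norm L2norm_sqr gradnorm_sqr /H1_ip big_ord_recl.
rewrite /H1_part unlift_none/=; congr (Num.sqrt (_ + _)).
by apply: eq_bigr => i _; rewrite liftK.
Qed.

Lemma is_CkB k phi psi : is_Ck k phi -> is_Ck k psi -> is_Ck k (phi \- psi).
Proof.
elim: k phi psi => [|k IH] phi psi /= [cf df] [cg dg].
  by split => // x; exact: (cvgB (cf x) (cg x)).
split=> [x|j]; first by exact: (cvgB (cf x) (cg x)).
have [[df1 df2] [dg1 dg2]] := (df j, dg j).
split=> [x|]; first exact: derivableB.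
rewrite (_ : 'D_ _ _ = 'D_(delta_mx 0 j) phi \- 'D_(delta_mx 0 j) psi).
  exact: IH.
by apply/funext => x; rewrite deriveB.
Qed.

Lemma smooth_sobB phi psi : smooth phi -> smooth psi ->
  smooth_sob (phi \- psi) = smooth_sob phi - smooth_sob psi.
Proof.
move=> sf sg; congr pair; apply/funext => j; apply/funext => x.
have [[_ df] [_ dg]] := (sf 1, sg 1).
by rewrite deriveB//; [exact: (df j).1|exact: (dg j).1].
Qed.

Lemma smooth_derive_continuous phi j : smooth phi ->
  continuous ('D_(delta_mx 0 j) phi : E -> R).
Proof. by move=> /(_ 1%N) [_ /(_ j)[_ []]]. Qed.

Section bounded.
Variable M : R.
Hypothesis OmM : Om `<=` box M.

Lemma continuous_L2 (mu : {measure set E -> \bar R}) D phi :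
  measurable D -> D `<=` box M -> (mu D < +oo)%E -> continuous phi ->
  L2 mu D phi.
Proof.
move=> mD DM muD cphi; have [K phiK] := continuous_bounded_box M cphi.
by apply: (L2_bounded mD muD (continuous_measurable cphi)) => x /DM; exact: phiK.
Qed.

Lemma continuous_L2_domain phi : continuous phi -> L2 (leb R d) Om phi.
Proof. exact: continuous_L2 mOm OmM (leb_sub_box mOm OmM). Qed.

Lemma smooth_sob_L2 phi : smooth phi ->
  forall i, L2 (leb R d) Om (H1_part i (smooth_sob phi)).
Proof.
move=> sphi; apply/H1_partP; split=> [|j]; apply: continuous_L2_domain.
  exact: (sphi 0%N).1.
exact: smooth_derive_continuous.
Qed.

(** The weak derivative passes to the difference because a derivative of a test
function is continuous, hence square integrable on the bounded domain, so that
both sides of the defining identity are honest inner products. *)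
Lemma H1B v w : H1 Om v -> H1 Om w -> H1 Om (v - w).
Proof.
move=> [v0 v1 vD] [w0 w1 wD].
have /H1_partP[vw0 vw1] : forall i, L2 (leb R d) Om (H1_part i (v - w)).
  by apply: (semi_inner_sub_closed semi_inner_H1); exact/H1_partP.
split=> // phi tphi j; have sphi := tphi.1.
have Dphi := continuous_L2_domain (@smooth_derive_continuous _ j sphi).
have L2phi := continuous_L2_domain (sphi 0%N).1.
have SB := semi_inner_L2 (leb R d) mOm.
have -> : fval (v - w) = (fval v : E -> R^o) - (fval w : E -> R^o) by [].
have -> : grad (v - w) j = (grad v j : E -> R^o) - (grad w j : E -> R^o) by [].
by rewrite !(semi_innerBl SB)// vD// wD// opprD.
Qed.

(** If [f n] and [g n] are smooth and approximate [v] and [w] together with their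
traces, then [f n - g n] approximates [v - w] together with the difference of
the traces, by the triangle inequality in H^1 and in L^2 of the boundary.  The
finiteness of the boundary measure makes the latter inequality available: it
puts the smooth functions in L^2 of the boundary. *)
Lemma H1_0B (sigma : {measure set E -> \bar R}) G v w :
  measurable (closure Om `\` Om) -> (sigma (closure Om `\` Om) < +oo)%E ->
  H1_0 sigma Om G v -> H1_0 sigma Om G w -> H1_0 sigma Om G (v - w).
Proof.
move=> mbd sbd [Hv [tv [[L2tv [f [sf fv ftv]]] tv0]]].
move=> [Hw [tw [[L2tw [g [sg gw gtw]]] tw0]]].
have SS := semi_inner_L2 sigma mbd.
split; first exact: H1B.
exists (tv \- tw); split; last first.
  apply: filterS2 tv0 tw0 => x tv0 tw0 Gx.
  by rewrite /= tv0// tw0// subr0.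
split; first exact: (semi_inner_sub_closed SS).
exists (fun n => f n \- g n); split=> [n k||]; first exact: is_CkB (sf n k) (sg n k).
- apply: (@squeeze_cvgr _ _ _ _ (cst 0) (fun n =>
    H1norm Om (smooth_sob (f n) - v) + H1norm Om (smooth_sob (g n) - w))).
  + apply: nearW => n; rewrite sqrtr_ge0/= !H1normE smooth_sobB//.
    rewrite (_ : _ - _ - _ = (smooth_sob (f n) - v) - (smooth_sob (g n) - w)).
      apply: (semi_norm_triangle semi_inner_H1);
        apply: (semi_inner_sub_closed semi_inner_H1) => /=.
      * exact: smooth_sob_L2.
      * by apply/H1_partP; case: Hv.
      * exact: smooth_sob_L2.
      * by apply/H1_partP; case: Hw.
    by rewrite !opprB addrACA [RHS]addrACA [X in _ = _ + X]addrC.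
  + exact: cvg_cst.
  + by rewrite -[X in _ --> X]addr0; exact: cvgD.
- apply: (@squeeze_cvgr _ _ _ _ (cst 0) (fun n =>
    L2norm sigma (closure Om `\` Om) (f n \- tv) +
    L2norm sigma (closure Om `\` Om) (g n \- tw))).
  + apply: nearW => n; rewrite sqrtr_ge0/= /L2norm.
    rewrite (_ : _ \- _ = ((f n - tv) - (g n - tw) : E -> R^o)); last first.
      apply/funext => x.
      rewrite [RHS](_ : _ = (f n x - tv x) - (g n x - tw x) :> R)//=; ring.
    have cL2 (h : nat -> E -> R) : (forall n, smooth (h n)) ->
        L2 sigma (closure Om `\` Om) (h n).
      move=> sh; apply: continuous_L2 => //; last exact: (sh n 0%N).1.
      by move=> x [/(closure_sub_box OmM)].
    by apply: (semi_norm_triangle SS); apply: (semi_inner_sub_closed SS) => //;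
      exact: cL2.
  + exact: cvg_cst.
  + by rewrite -[X in _ --> X]addr0; exact: cvgD.
Qed.

End bounded.

End sobolev_space.

(** * Strain and divergence of vector fields *)

Section vector_fields.
Context (R : realType) (d : nat) (Om : set 'rV[R]_d).
Local Notation E := 'rV[R]_d.
Local Notation ip := (ip (leb R d) Om).
Local Notation L2 := (L2 (leb R d) Om).
Implicit Types (u v w : vsob R d) (phi : E -> R).
Hypothesis mOm : measurable Om.

Let ipS := semi_inner_L2 (leb R d) mOm.

Definition vgrad_L2 v := forall i j, L2 (grad (v i) j).

Definition strain_comp (ij : 'I_d * 'I_d) v : E -> R^o := strain v ij.1 ij.2.

Definition strain_form u v := \sum_ij ip (strain_comp ij u) (strain_comp ij v).

Lemma strain_compE ij v : strain_comp ij v =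
  2^-1 *: ((grad (v ij.1) ij.2 : E -> R^o) + (grad (v ij.2) ij.1 : E -> R^o)).
Proof. by apply/funext => x; rewrite /strain_comp /strain mulrC. Qed.

Lemma strain_comp_lin ij a u v :
  strain_comp ij (a *: u + v) = a *: strain_comp ij u + strain_comp ij v.
Proof.
rewrite !strain_compE scalerA [a * _]mulrC -scalerA -scalerDr; congr (_ *: _).
by rewrite scalerDr addrACA.
Qed.

Lemma semi_inner_strain :
  @semi_inner R (vsob R d) [set v | forall ij, L2 (strain_comp ij v)] strain_form.
Proof. exact: semi_inner_pullback ipS strain_comp_lin. Qed.

Lemma L2D (f g : E -> R^o) : L2 f -> L2 g -> L2 (f + g).
Proof. by move=> Lf Lg; rewrite -[f]scale1r; exact: L2_lin. Qed.

Lemma L2_0 : L2 (fun=> 0).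
Proof.
rewrite /L2 (_ : _ \_ _ = 0); last by apply/funext => x; rewrite /patch; case: ifP.
exact: (Lfun_submod_closed _ (lee1n 2)).1.
Qed.

Lemma L2Z a (f : E -> R^o) : L2 f -> L2 (a *: f).
Proof. by move=> Lf; rewrite -[_ *: _]addr0; apply: L2_lin => //; exact: L2_0. Qed.

Lemma strain_comp_L2 v : vgrad_L2 v -> forall ij, L2 (strain_comp ij v).
Proof. by move=> Lv ij; rewrite strain_compE; apply: L2Z; apply: L2D. Qed.

Lemma strain_ipE u v : vgrad_L2 u -> vgrad_L2 v ->
  strain_ip Om u v = strain_form u v.
Proof.
move=> /strain_comp_L2 Lu /strain_comp_L2 Lv.
rewrite /strain_form -Rintegral_sum_L2//.
by apply: eq_Rintegral => x _; rewrite pair_bigA.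
Qed.

Lemma vH1norm_sqr v : vH1norm Om v ^+ 2 = \sum_j H1norm Om (v j) ^+ 2.
Proof. by rewrite sqr_sqrtr// sumr_ge0// => j _; exact: sqr_ge0. Qed.

Lemma sum_grad_le v :
  \sum_i \sum_j ip (grad (v i) j) (grad (v i) j) <= vH1norm Om v ^+ 2.
Proof.
rewrite vH1norm_sqr; apply: ler_sum => i _.
rewrite /H1norm sqr_sqrtr ?addr_ge0 ?sqr_ge0// -gradnorm_sqr.
by rewrite lerDr sqr_ge0.
Qed.

(** Symmetrization is a contraction of the Frobenius norm: each entry satisfies
[|(a + b)/2|^2 <= |a|^2/2 + |b|^2/2], and summing over all pairs of indices the
two halves have equal sums.  The sharp constant 1 is what makes the contraction
factor independent of the dimension. *)
Lemma strain_form_le v : vgrad_L2 v -> strain_form v v <= vH1norm Om v ^+ 2.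
Proof.
move=> Lv; apply: le_trans (sum_grad_le v).
pose q i j := ip (grad (v i) j) (grad (v i) j).
apply: (@le_trans _ _ (\sum_ij (2^-1 * q ij.1 ij.2 + 2^-1 * q ij.2 ij.1))).
  apply: ler_sum => -[i j] _; rewrite strain_compE /=.
  have := semi_innerD_le ipS (L2Z 2^-1 (Lv i j)) (L2Z 2^-1 (Lv j i)).
  rewrite -scalerDr => /le_trans; apply.
  have half (f : E -> R^o) : L2 f ->
      ip (2^-1 *: f) (2^-1 *: f) = 4^-1 * ip f f.
    move=> Lf; have Lhf := L2Z 2^-1 Lf.
    by rewrite (semi_innerZl ipS)// (semi_innerC ipS) (semi_innerZl ipS)//; field.
  by rewrite !half// /q; lra.
rewrite big_split/= -(pair_bigA _ (fun i j => 2^-1 * q i j))/=.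
rewrite -(pair_bigA _ (fun i j => 2^-1 * q j i))/= [X in _ + X]exchange_big/=.
rewrite -big_split/=; apply: ler_sum => i _; rewrite -big_split/=.
by apply: ler_sum => j _; rewrite -mulrDl; rewrite (_ : 2^-1 + 2^-1 = 1) ?mul1r//; field.
Qed.

Lemma strain_norm_le v : vgrad_L2 v -> strain_norm Om v <= vH1norm Om v.
Proof.
move=> Lv; rewrite /strain_norm strain_ipE//.
by rewrite -[leRHS]ger0_norm ?sqrtr_ge0// -sqrtr_sqr ler_wsqrtr// strain_form_le.
Qed.

Lemma strain_norm_sqr v : strain_norm Om v ^+ 2 = strain_ip Om v v.
Proof.
rewrite sqr_sqrtr// Rintegral_ge0// => x _.
by do 2! apply: sumr_ge0 => ? _; rewrite -expr2 sqr_ge0.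
Qed.

Lemma strain_cauchy_schwarz u v : vgrad_L2 u -> vgrad_L2 v ->
  `|strain_ip Om u v| <= strain_norm Om u * strain_norm Om v.
Proof.
move=> Lu Lv; rewrite /strain_norm !strain_ipE//.
by apply: (cauchy_schwarz semi_inner_strain); exact: strain_comp_L2.
Qed.

Lemma vgrad_L2B u v : vgrad_L2 u -> vgrad_L2 v -> vgrad_L2 (u - v).
Proof. by move=> Lu Lv i j; exact: (semi_inner_sub_closed ipS (Lu i j) (Lv i j)). Qed.

Lemma strain_ipBl u v w : vgrad_L2 u -> vgrad_L2 v -> vgrad_L2 w ->
  strain_ip Om (u - v) w = strain_ip Om u w - strain_ip Om v w.
Proof.
move=> Lu Lv Lw; rewrite !strain_ipE//; last exact: vgrad_L2B.
by rewrite (semi_innerBl semi_inner_strain)//; exact: strain_comp_L2.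
Qed.

Lemma divergence_L2 v : vgrad_L2 v -> L2 (divergence v).
Proof.
move=> Lv; rewrite /divergence; elim: (index_enum _) => [|i s IH].
  by under eq_fun do rewrite big_nil; exact: L2_0.
by under eq_fun do rewrite big_cons; exact: L2D.
Qed.

Lemma divergenceB u v :
  divergence (u - v) = (divergence u : E -> R^o) - (divergence v : E -> R^o).
Proof. by apply/funext => x; exact: sumrB. Qed.

Lemma form_bBl u v phi : vgrad_L2 u -> vgrad_L2 v -> L2 phi ->
  form_b Om (u - v) phi = form_b Om u phi - form_b Om v phi.
Proof.
by move=> Lu Lv Lp; rewrite /form_b divergenceB (semi_innerBr ipS)//;
  exact: divergence_L2.
Qed.

Lemma form_bBr v (phi psi : E -> R^o) : vgrad_L2 v -> L2 phi -> L2 psi ->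
  form_b Om v (phi - psi) = form_b Om v phi - form_b Om v psi.
Proof.
by move=> Lv Lf Lp; rewrite /form_b (semi_innerBl ipS)//; exact: divergence_L2.
Qed.

(** The divergence is a sum of [d] entries of the gradient; this crude constant
only enters the estimate of the displacement. *)
Lemma form_b_le v phi : vgrad_L2 v -> L2 phi ->
  `|form_b Om v phi| <= d%:R * L2norm (leb R d) Om phi * vH1norm Om v.
Proof.
move=> Lv Lp; have -> : form_b Om v phi = \sum_i ip phi (grad (v i) i).
  rewrite -(Rintegral_sum_L2 mOm (f := fun=> phi))//.
  by apply: eq_Rintegral => x _; rewrite mulr_sumr.
apply: (le_trans (ler_norm_sum _ _ _)).
rewrite -mulrA mulr_natl -[X in _ *+ X]card_ord -sumr_const.
apply: ler_sum => i _; apply: (le_trans (cauchy_schwarz ipS Lp (Lv i i))).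
rewrite ler_wpM2l ?sqrtr_ge0//.
rewrite -[leRHS]ger0_norm ?sqrtr_ge0// -sqrtr_sqr ler_wsqrtr//.
apply: le_trans (sum_grad_le v).
rewrite (bigD1 i)//= (bigD1 i)//= -addrA lerDl addr_ge0// sumr_ge0// => *.
  exact: ip_ge0.
by apply: sumr_ge0 => *; exact: ip_ge0.
Qed.

End vector_fields.

(** * The discrete spaces are closed under subtraction *)

Section finite_element_spaces.
Context (R : realType) (d : nat) (Om : set 'rV[R]_d).
Context (sigma : {measure set 'rV[R]_d -> \bar R}) (Th : seq 'M[R]_(d.+1, d)).
Local Notation E := 'rV[R]_d.

Lemma cont_pw_polyB k (f g : E -> R^o) :
  cont_pw_poly Om Th k f -> cont_pw_poly Om Th k g ->
  cont_pw_poly Om Th k (f - g).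
Proof.
move=> [cf pf] [cg pg]; split=> [x|V VTh].
  exact: (cvgB (cf x) (cg x)).
have [[a fa] [b gb]] := (pf V VTh, pg V VTh).
exists (fun i => a i - b i) => x Vx; rewrite !fctE fa// gb// -sumrB.
by apply: eq_bigr => i _; rewrite mulrBl.
Qed.

Variable M : R.
Hypotheses (mOm : measurable Om) (OmM : Om `<=` box M).
Hypotheses (mbd : measurable (closure Om `\` Om)).
Hypotheses (sbd : (sigma (closure Om `\` Om) < +oo)%E).

Lemma WhB k (f g : E -> R^o) : Wh Om Th k f -> Wh Om Th k g -> Wh Om Th k (f - g).
Proof.
move=> [Lf pf] [Lg pg]; split; last exact: cont_pw_polyB.
exact: (semi_inner_sub_closed (semi_inner_L2 _ mOm)).
Qed.

Lemma MhB G l v w : Mh sigma Om Th G l v -> Mh sigma Om Th G l w ->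
  Mh sigma Om Th G l (v - w).
Proof.
move=> [Hv pv] [Hw pw]; split; last exact: cont_pw_polyB.
exact: (H1_0B mOm OmM).
Qed.

Lemma VhB G k v w : Vh sigma Om Th G k v -> Vh sigma Om Th G k w ->
  Vh sigma Om Th G k (v - w).
Proof.
move=> [Hv pv] [Hw pw]; split=> j; last exact: cont_pw_polyB (pv j) (pw j).
exact: (H1_0B mOm OmM mbd sbd (Hv j) (Hw j)).
Qed.

Lemma Vh_vgrad_L2 G k v : Vh sigma Om Th G k v -> vgrad_L2 Om v.
Proof. by move=> [Hv _] i; case: (Hv i) => -[]. Qed.

Lemma Mh_L2 G l v : Mh sigma Om Th G l v ->
  L2 (leb R d) Om (fval v) /\ forall j, L2 (leb R d) Om (grad v j).
Proof. by move=> [[[]]]. Qed.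

End finite_element_spaces.

(** * The estimates for one step of the iteration *)

Section forms.
Context (R : realType) (d : nat) (Om : set 'rV[R]_d).
Local Notation E := 'rV[R]_d.
Local Notation ip := (ip (leb R d) Om).
Local Notation L2 := (L2 (leb R d) Om).
Local Notation L2norm := (L2norm (leb R d) Om).
Implicit Types (p q psi : sob R d) (u v : vsob R d) (x y : E -> R^o).
Hypothesis mOm : measurable Om.

Let ipS := semi_inner_L2 (leb R d) mOm.

Definition grad_form p q := \sum_j ip (grad p j) (grad q j).

Lemma semi_inner_grad :
  @semi_inner R (sob R d) [set q | forall j, L2 (grad q j)] grad_form.
Proof. exact: (semi_inner_pullback (L := fun j q => grad q j) ipS). Qed.

Lemma ip_le x y : L2 x -> L2 y -> ip x y <= L2norm x * L2norm y.
Proof.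
by move=> Lx Ly; exact: (le_trans (ler_norm _) (cauchy_schwarz ipS Lx Ly)).
Qed.

(** Expanded in this way, two instances with the same previous time step [q0] and
[x0] can be subtracted. *)
Lemma flow_equationE (lam alpha kp c0 dt : R) p q0 psi x x0 :
  (forall i, L2 (H1_part i p)) -> (forall i, L2 (H1_part i q0)) ->
  (forall i, L2 (H1_part i psi)) -> L2 x -> L2 x0 ->
  form_a3 Om lam alpha c0 (fval (dt^-1 *: (p - q0))) (fval psi)
    - form_c Om lam alpha (fval psi) (fun t => (x t - x0 t) / dt)
    + form_d Om kp (2^-1 *: (p + q0)) psi =
  (c0 + alpha ^+ 2 / lam) / dt * (ip (fval p) (fval psi) - ip (fval q0) (fval psi))
    - alpha / lam / dt * (ip (fval psi) x - ip (fval psi) x0)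
    + kp / 2 * (grad_form p psi + grad_form q0 psi).
Proof.
move=> /H1_partP[Lp Lgp] /H1_partP[Lq Lgq] /H1_partP[Ls Lgs] Lx Lx0.
rewrite /form_a3 /form_c /form_d; congr (_ - _ + _).
- have -> : fval (dt^-1 *: (p - q0)) =
    dt^-1 *: ((fval p : E -> R^o) - (fval q0 : E -> R^o)) by [].
  by rewrite (semi_innerZl ipS)// ?(semi_innerBl ipS)// ?mulrA//;
    exact: (semi_inner_sub_closed ipS).
- have -> : (fun t => (x t - x0 t) / dt) = dt^-1 *: (x - x0).
    by apply/funext => t; rewrite mulrC.
  rewrite (semi_innerC ipS) (semi_innerZl ipS)//; last exact: (semi_inner_sub_closed ipS).
  by rewrite (semi_innerC ipS) (semi_innerBr ipS)// mulrA.
rewrite Rintegral_sum_L2//; last first.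
  by move=> j; exact: (L2Z 2^-1 (L2D (Lgp j) (Lgq j))).
rewrite -big_split/= -!mulrA; congr (_ * _); rewrite mulr_sumr; apply: eq_bigr => j _.
transitivity (ip (2^-1 *: (1 *: (grad p j : E -> R^o) + (grad q0 j : E -> R^o)))
  (grad psi j)); first by rewrite scale1r.
rewrite (semi_innerZl ipS)//; last by rewrite scale1r; exact: L2D.
by rewrite (semi_innerPl ipS)// mul1r.
Qed.

(** Both schemes start from the same previous time step and have the same load,
so only the differences of the new pressures and of the total pressures
survive. *)
Lemma flow_equationB (lam alpha kp c0 dt r : R) p q q0 psi x y x0 :
  (forall i, L2 (H1_part i p)) -> (forall i, L2 (H1_part i q)) ->
  (forall i, L2 (H1_part i q0)) -> (forall i, L2 (H1_part i psi)) ->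
  L2 x -> L2 y -> L2 x0 ->
  form_a3 Om lam alpha c0 (fval (dt^-1 *: (p - q0))) (fval psi)
    - form_c Om lam alpha (fval psi) (fun t => (x t - x0 t) / dt)
    + form_d Om kp (2^-1 *: (p + q0)) psi = r ->
  form_a3 Om lam alpha c0 (fval (dt^-1 *: (q - q0))) (fval psi)
    - form_c Om lam alpha (fval psi) (fun t => (y t - x0 t) / dt)
    + form_d Om kp (2^-1 *: (q + q0)) psi = r ->
  (c0 + alpha ^+ 2 / lam) / dt * ip (fval (p - q)) (fval psi)
    + kp / 2 * grad_form (p - q) psi
  = alpha / lam / dt * ip (fval psi) (x - y).
Proof.
move=> Lp Lq Lq0 Ls Lx Ly Lx0; rewrite !flow_equationE// => <-.
move: Lp Lq Ls => /H1_partP[Lp Lgp] /H1_partP[Lq Lgq] /H1_partP[Ls Lgs].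
rewrite (semi_innerBl semi_inner_grad)// (semi_innerBr ipS)//.
rewrite (semi_innerBl ipS Lp Lq Ls); lra.
Qed.

(** Here [P], [G], [X] stand for the norms of the pressure error, of its gradient
and of the previous total pressure error.  By [P <= CP * G] the gradient term is
at least [kp/2 (P/CP)^2]; then multiply by [lam dt / (alpha P)]. *)
Lemma pressure_estimate (lam alpha kp c0 dt CP P G X : R) :
  0 < lam -> 0 < alpha -> 0 < kp -> 0 <= c0 -> 0 < dt -> 0 < CP ->
  0 <= P -> 0 <= G -> 0 <= X -> P <= CP * G ->
  (c0 + alpha ^+ 2 / lam) / dt * P ^+ 2 + kp / 2 * G ^+ 2
    <= alpha / lam / dt * (P * X) ->
  (c0 * lam / alpha ^+ 2 + kp * dt * lam / (2 * CP ^+ 2 * alpha ^+ 2) + 1)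
    * (alpha * P) <= X.
Proof.
move=> l0 a0 k0 c00 t0 CP0; rewrite le_eqVlt => /predU1P[<-|P0] G0 X0 PG.
  by rewrite !mulr0.
move=> h; have PG2 : P ^+ 2 / CP ^+ 2 <= G ^+ 2.
  rewrite ler_pdivrMr ?exprn_gt0// mulrC -exprMn.
  by rewrite lerXn2r ?nnegrE ?mulr_ge0 ?(ltW P0) ?(ltW CP0).
have {}h : (c0 + alpha ^+ 2 / lam) / dt * P ^+ 2 + kp / 2 * (P ^+ 2 / CP ^+ 2)
    <= alpha / lam / dt * (P * X).
  by apply: le_trans h; rewrite lerD2l ler_wpM2l// divr_ge0// ltW.
have w0 : 0 < lam * dt / (alpha * P) by rewrite !(divr_gt0, mulr_gt0).
rewrite -(ler_pM2l w0) in h.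
apply: le_trans (le_trans h _); rewrite le_eqVlt; apply/orP; left; apply/eqP.
  by field; rewrite !gt_eqF.
by field; rewrite !gt_eqF.
Qed.

(** Dropping the mass term and using Poincare on the right instead, one factor [G]
cancels: this bounds the gradient even if [c0] vanishes. *)
Lemma gradient_estimate (a k CP P G X : R) :
  0 <= a -> 0 < k -> 0 < CP -> 0 <= P -> 0 <= G -> 0 <= X -> P <= CP * G ->
  k / 2 * G ^+ 2 <= a * (P * X) -> G <= 2 * a * CP / k * X.
Proof.
move=> a0 k0 CP0 P0; rewrite le_eqVlt => /predU1P[<-|G0] X0 PG h.
  by rewrite !mulr_ge0// ?ltW// invr_gt0.
have {}h : k / 2 * G ^+ 2 <= a * (CP * G * X).
  by apply: le_trans h _; rewrite ler_wpM2l// ler_wpM2r.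
have w0 : 0 < 2 / (k * G) by rewrite !(divr_gt0, mulr_gt0).
rewrite -(ler_pM2l w0) in h.
apply: le_trans (le_trans h _); rewrite le_eqVlt; apply/orP; left; apply/eqP.
  by field; rewrite !gt_eqF.
by field; rewrite !gt_eqF.
Qed.

Lemma pressure_H1_estimate CP q : 0 < CP -> L2norm (fval q) <= CP * gradnorm Om q ->
  H1norm Om q <= (CP + 1) * gradnorm Om q.
Proof.
move=> CP0 h; have P0 : 0 <= L2norm (fval q) by exact: sqrtr_ge0.
have G0 : 0 <= gradnorm Om q by exact: sqrtr_ge0.
have CG0 : 0 <= (CP + 1) * gradnorm Om q by rewrite mulr_ge0// addr_ge0// ltW.
rewrite -[leRHS]ger0_norm// -sqrtr_sqr /H1norm ler_wsqrtr//.
apply: (@le_trans _ _ ((L2norm (fval q) + gradnorm Om q) ^+ 2)); first by nra.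
by rewrite lerXn2r ?nnegrE ?addr_ge0// mulrDl mul1r lerD2r.
Qed.

(** By the momentum equation each quotient in the supremum equals
[a1(u, v) / |v|_H1], and Cauchy-Schwarz for the strain bounds it uniformly
in [v]. *)
Lemma inf_sup_strain mu beta V (W : set (E -> R)) u x :
  0 < mu -> inf_sup Om V W beta -> (forall v, V v -> vgrad_L2 Om v) ->
  V u -> W x ->
  (forall v, V v -> form_a1 Om mu u v = form_b Om v x) ->
  beta * L2norm x <= 2 * mu * strain_norm Om u.
Proof.
move=> mu0 infsup VL2 Vu Wx eq_uv; rewrite -lee_fin; apply: (le_trans (infsup _ Wx)).
apply: ge_ereal_sup => _ [v [Vv /= v0] <-]; rewrite lee_fin.
have {}v0 : 0 < vH1norm Om v by rewrite lt_def v0 sqrtr_ge0.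
rewrite ler_pdivrMr// -eq_uv// /form_a1 -[leRHS]mulrA ler_wpM2l//.
  by rewrite mulr_ge0// ltW.
apply: (le_trans (ler_norm _)).
apply: (le_trans (strain_cauchy_schwarz mOm (VL2 _ Vu) (VL2 _ Vv))).
by rewrite ler_wpM2l ?sqrtr_ge0// strain_norm_le//; exact: VL2.
Qed.

(** Here [S], [P], [X] stand for the norms of the strain of the displacement
error, of the pressure error and of the total pressure error.  Squaring the
inf-sup bound gives [beta^2/(2 mu) X^2 <= 2 mu S^2]; inserting it in the energy
balance and multiplying by [lam / X] gives the claim. *)
Lemma total_pressure_estimate (mu lam alpha beta S P X : R) :
  0 < mu -> 0 < lam -> 0 < alpha -> 0 < beta -> 0 <= P -> 0 <= X ->
  beta * X <= 2 * mu * S ->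
  2 * mu * S ^+ 2 + lam^-1 * X ^+ 2 <= alpha / lam * (P * X) ->
  (beta ^+ 2 / (2 * mu) * lam + 1) * X <= alpha * P.
Proof.
move=> mu0 l0 a0 b0 P0; rewrite le_eqVlt => /predU1P[<-|X0] bXS h.
  by rewrite mulr0 mulr_ge0// ltW.
have {}bXS : beta ^+ 2 / (2 * mu) * X ^+ 2 <= 2 * mu * S ^+ 2.
  have := lerXn2r 2 _ _ bXS; rewrite !nnegrE.
  have bX0 : 0 <= beta * X by rewrite mulr_ge0// ltW.
  move=> /(_ bX0 (le_trans bX0 bXS)).
  have w0 : 0 < (2 * mu)^-1 by rewrite invr_gt0 mulr_gt0.
  rewrite -(ler_pM2l w0) => {}bXS.
  apply: le_trans (le_trans bXS _); rewrite le_eqVlt; apply/orP; left; apply/eqP.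
    by field; rewrite gt_eqF.
  by field; rewrite gt_eqF.
have w0 : 0 < lam / X by rewrite divr_gt0.
have {}h : lam / X * (beta ^+ 2 / (2 * mu) * X ^+ 2 + lam^-1 * X ^+ 2)
    <= lam / X * (alpha / lam * (P * X)).
  by rewrite ler_pM2l//; apply: le_trans h; rewrite lerD2r.
apply: le_trans (le_trans h _); rewrite le_eqVlt; apply/orP; left; apply/eqP.
  by field; rewrite !gt_eqF.
by field; rewrite !gt_eqF.
Qed.

End forms.

(** * Contraction and convergence *)

Lemma contraction_factor_itv (R : realType) (lam alpha kp c0 dt CP C : R) :
  0 < lam -> 0 < alpha -> 0 < kp -> 0 <= c0 -> 0 < dt -> 0 < CP -> 0 < C ->
  0 < contraction_factor lam alpha kp c0 dt CP C < 1.
Proof.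
move=> l0 a0 k0 c00 t0 CP0 C0; rewrite /contraction_factor.
set A := _ + _ + 1; have A1 : 1 < A.
  rewrite ltrDr ltr_wpDl//; first by rewrite divr_ge0 ?mulr_ge0 ?exprn_ge0// ltW.
  by rewrite divr_gt0 ?mulr_gt0 ?exprn_gt0.
have B1 : 1 < C * lam + 1 by rewrite ltrDr mulr_gt0.
have AB1 : 1 < A * (C * lam + 1) by rewrite mulr_egt1.
have AB0 := lt_trans ltr01 AB1.
by rewrite div1r invr_gt0 AB0 invf_lt1.
Qed.

Lemma geometric_cvg0 (R : realType) (L : R) (e : nat -> R) : 0 < L < 1 ->
  (forall i, 0 <= e i) -> (forall i, (1 <= i)%N -> e i <= L * e i.-1) ->
  e @ \oo --> (0 : R).
Proof.
move=> /andP[L0 L1] e0 eL.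
have eLn i : e i <= L ^+ i * e 0%N.
  elim: i => [|i IH]; first by rewrite expr0 mul1r.
  by apply: (le_trans (eL i.+1 isT)); rewrite exprS -mulrA ler_wpM2l// ltW.
apply: (@squeeze_cvgr _ _ _ _ (cst 0) (fun i => L ^+ i * e 0%N)).
- by apply: nearW => i; rewrite e0 eLn.
- exact: cvg_cst.
- rewrite -[X in _ --> X](mul0r (e 0%N)); apply: cvgMl.
  by apply: cvg_expr; rewrite gtr0_norm.
Qed.

Lemma polyhedral_domain_box (R : realType) d (Om : set 'rV[R]_d) F :
  polyhedral_domain Om F ->
  [/\ measurable Om, exists M, Om `<=` box M & measurable (closure Om `\` Om)].
Proof.
move=> [oOm _ _ bOm _]; have mOm := open_measurable_mx oOm.
split=> //; first exact: bounded_sub_box.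
apply: measurableD => //; rewrite -[closure Om]setCK; apply: measurableC.
apply: open_measurable_mx; rewrite openC; exact: closed_closure.
Qed.

Theorem theorem3p2 (R : realType) :
  (* C(beta, mu), depending only on beta and mu *)
  exists2 Cbm : R -> R -> R,
    (forall beta mu : R, 0 < beta -> 0 < mu -> 0 < Cbm beta mu) &
  forall (d : nat) (Om : set 'rV[R]_d) (F : seq 'M[R]_(d.-1.+1, d))
    (Gu Gs Gp Gq : set 'rV[R]_d) (lam mu alpha kp c0 dt CK CP : R),
  let sigma := surface_measure F in
  let leb := leb R d in
  d = 2%N \/ d = 3%N ->
  polyhedral_domain Om F ->
  boundary_split Om Gu Gs ->
  boundary_split Om Gp Gq ->
  (0 < sigma Gu)%E ->
  (0 < sigma Gp)%E ->
  0 < lam -> 0 < mu -> 0 < alpha -> 0 < kp -> 0 <= c0 -> 0 < dt ->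
  0 < CK -> korn sigma Om Gu CK ->
  0 < CP -> poincare sigma Om Gp CP ->
  (* the constants hidden in the two estimates with unspecified constants *)
  exists C1 : R, exists C2 : R,
  [/\ 0 < C1, 0 < C2 &
  forall (T : R) (N : nat) (f f1 : R -> 'I_d -> 'rV[R]_d -> R)
    (g g1 : R -> 'rV[R]_d -> R) (Th : seq 'M[R]_(d.+1, d)) (k l : nat)
    (beta : R)
    (u : nat -> vsob R d) (xi : nat -> 'rV[R]_d -> R) (p : nat -> sob R d)
    (n : nat)
    (ui : nat -> vsob R d) (xii : nat -> 'rV[R]_d -> R) (pii : nat -> sob R d),
  let t m : R := m%:R * dt in
  let V := Vh sigma Om Th Gu k in
  let W := Wh Om Th k in
  let M := Mh sigma Om Th Gp l in
  let flow_load m psi :=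
    2^-1 * ip leb Om (g (t m) \+ g (t m.-1)) psi
    + 2^-1 * ip sigma Gq (g1 (t m) \+ g1 (t m.-1)) psi in
  let body_load m (v : vsob R d) :=
    vip leb Om (f (t m)) (fun j => fval (v j))
    + vip sigma Gs (f1 (t m)) (fun j => fval (v j)) in
  0 < T -> (0 < N)%N -> t N = T ->
  (forall s, 0 <= s <= T ->
    [/\ forall j, L2 leb Om (f s j), forall j, L2 sigma Gs (f1 s j),
        L2 leb Om (g s) & L2 sigma Gq (g1 s)]) ->
  simplicial_partition (closure Om) Th ->
  (2 <= k)%N -> (1 <= l)%N ->
  0 < beta -> inf_sup Om V W beta ->
  (* the coupled algorithm *)
  (forall m, (m <= N)%N -> [/\ V (u m), W (xi m) & M (p m)]) ->
  (forall m, (1 <= m <= N)%N ->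
    [/\ forall v, V v -> form_a1 Om mu (u m) v - form_b Om v (xi m) = body_load m v,
        forall phi, W phi ->
          form_b Om (u m) phi + form_a2 Om lam (xi m) phi
          - form_c Om lam alpha (fval (p m)) phi = 0 &
        forall psi, M psi ->
          form_a3 Om lam alpha c0 (fval (dt^-1 *: (p m - p m.-1))) (fval psi)
          - form_c Om lam alpha (fval psi) (fun x => (xi m x - xi m.-1 x) / dt)
          + form_d Om kp (2^-1 *: (p m + p m.-1)) psi
          = flow_load m (fval psi)]) ->
  (1 <= n <= N)%N ->
  (* the iterative decoupled algorithm at time step n *)
  ui 0%N = u n.-1 -> xii 0%N = xi n.-1 -> pii 0%N = p n.-1 ->
  (forall i, (1 <= i)%N -> M (pii i) /\
    forall psi, M psi ->
      form_a3 Om lam alpha c0 (fval (dt^-1 *: (pii i - p n.-1))) (fval psi)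
      - form_c Om lam alpha (fval psi) (fun x => (xii i.-1 x - xi n.-1 x) / dt)
      + form_d Om kp (2^-1 *: (pii i + p n.-1)) psi
      = flow_load n (fval psi)) ->
  (forall i, (1 <= i)%N ->
    [/\ V (ui i), W (xii i),
        forall v, V v -> form_a1 Om mu (ui i) v - form_b Om v (xii i) = body_load n v &
        forall phi, W phi ->
          form_b Om (ui i) phi + form_a2 Om lam (xii i) phi
          = form_c Om lam alpha (fval (pii i)) phi]) ->
  let eu i : vsob R d := ui i - u n in
  let exi i : 'rV[R]_d -> R := xii i \- xi n in
  let ep i : sob R d := pii i - p n in
  let Ls := contraction_factor lam alpha kp c0 dt CP (Cbm beta mu) in
  [/\ [/\ (fun i => vH1norm Om (eu i)) @ \oo --> (0 : R),
          (fun i => L2norm leb Om (exi i)) @ \oo --> (0 : R) &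
          (fun i => H1norm Om (ep i)) @ \oo --> (0 : R)],
      0 < Ls < 1,
      forall i, (1 <= i)%N ->
        L2norm leb Om (exi i) <= Ls * L2norm leb Om (exi i.-1),
      forall i, (1 <= i)%N ->
        H1norm Om (ep i) <= C1 * L2norm leb Om (exi i.-1) &
      forall i, (1 <= i)%N ->
        vH1norm Om (eu i) <= C2 * L2norm leb Om (exi i)]].
Proof.
exists (fun beta mu => beta ^+ 2 / (2 * mu)).
  by move=> beta mu b0 mu0; rewrite divr_gt0 ?exprn_gt0 ?mulr_gt0.
move=> d Om F Gu Gs Gp Gq lam mu alpha kp c0 dt CK CP sigma leb d23 polOm _ _ _ _.
move=> l0 mu0 a0 k0 c00 t0 CK0 kornCK CP0 poinCP.
have d0 : (0 < d)%N by case: d23 => ->.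
have [mOm [M OmM] mbd] := polyhedral_domain_box polOm.
have sbd := surface_measure_fin F mbd.
have ipS := semi_inner_L2 leb mOm.
have al0 : 0 <= alpha / lam by rewrite divr_ge0// ltW.
have ald0 : 0 <= alpha / lam / dt by rewrite divr_ge0// ltW.
have CP10 : 0 <= CP + 1 by rewrite addr_ge0// ltW.
have CK0' := ltW CK0.
have mu20 : 0 < 2 * mu by rewrite mulr_gt0.
exists ((CP + 1) * (2 * (alpha / lam / dt) * CP / kp)), (d%:R / (2 * mu) * CK ^+ 2).
split=> [||T N f f1 g g1 Th k l beta u xi p n ui xii pii t V W Mp flow_load body_load].
- by rewrite !(divr_gt0, mulr_gt0, addr_gt0).
- by rewrite mulr_gt0 ?divr_gt0 ?mulr_gt0 ?exprn_gt0 ?ltr0n.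
move=> _ _ _ _ _ _ _ b0 infsup inspaces coupled nN ui0 xii0 pii0 stepa stepb.
move=> eu exi ep Ls.
have /andP[n1 nlN] := nN.
have [Vu Wxi Mpn] := inspaces n nlN.
have [_ Wxi0 Mp0] := inspaces n.-1 (leq_trans (leq_pred n) nlN).
have [eqa eqb eqc] := coupled n nN.
have Wxii i : W (xii i).
  by case: i => [|i]; [rewrite xii0|case: (stepb i.+1 isT)].
have WL2 (x : 'rV[R]_d -> R^o) : W x -> L2 leb Om x by case.
have VL2 v : V v -> vgrad_L2 Om v by exact: Vh_vgrad_L2.
have ML2 q : Mp q -> forall i, L2 leb Om (H1_part i q).
  by move=> /Mh_L2 Mq; apply/H1_partP.
have Wexi i : W (exi i) by exact: (WhB mOm (Wxii i) Wxi).
have Mep i : (1 <= i)%N -> Mp (ep i).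
  by move=> /stepa[Mpi _]; exact: (MhB mOm OmM mbd sbd Mpi Mpn).
have Veu i : (1 <= i)%N -> V (eu i).
  by move=> /stepb[Vui _ _ _]; exact: (VhB mOm OmM mbd sbd Vui Vu).
pose P i := L2norm leb Om (fval (ep i)).
pose G i := gradnorm Om (ep i).
pose X i := L2norm leb Om (exi i).
pose S i := strain_norm Om (eu i).
have PG i : (1 <= i)%N -> P i <= CP * G i.
  by move=> /Mep[He _]; exact: poinCP.
(* the error equation of the flow, tested with the pressure error *)
have flow i : (1 <= i)%N ->
  (c0 + alpha ^+ 2 / lam) / dt * P i ^+ 2 + kp / 2 * G i ^+ 2
    <= alpha / lam / dt * (P i * X i.-1).
  move=> i1; have [Mpi eqi] := stepa i i1.
  have := flow_equationB mOm (ML2 _ Mpi) (ML2 _ Mpn) (ML2 _ Mp0)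
    (ML2 _ (Mep i i1)) (WL2 _ (Wxii i.-1)) (WL2 _ Wxi) (WL2 _ Wxi0)
    (eqi _ (Mep i i1)) (eqc _ (Mep i i1)).
  rewrite /P /G L2norm_sqr gradnorm_sqr => ->.
  rewrite ler_wpM2l//.
  exact: (ip_le mOm (Mh_L2 (Mep i i1)).1 (WL2 _ (Wexi i.-1))).
have X0 i : 0 <= X i by exact: sqrtr_ge0.
have P0 i : 0 <= P i by exact: sqrtr_ge0.
have G0 i : 0 <= G i by exact: sqrtr_ge0.
have S0 i : 0 <= S i by exact: sqrtr_ge0.
(* the loads cancel, since both schemes have the same data at time t n *)
have momentum i : (1 <= i)%N -> forall v, V v ->
    form_a1 Om mu (eu i) v = form_b Om v (exi i).
  move=> i1 v Vv; have [Vui Wi ai _] := stepb i i1.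
  rewrite (form_bBr mOm (VL2 _ Vv) (WL2 _ Wi) (WL2 _ Wxi)).
  rewrite /form_a1 (strain_ipBl mOm (VL2 _ Vui) (VL2 _ Vu) (VL2 _ Vv)) mulrBr.
  have := ai v Vv; rewrite -(eqa v Vv) /form_a1; lra.
have strain_energy i : (1 <= i)%N -> 2 * mu * S i ^+ 2 = form_b Om (eu i) (exi i).
  by move=> i1; rewrite strain_norm_sqr -momentum//; exact: Veu.
(* the total pressure error equation tested with exi, in which b(eu, exi) is
   the elastic energy by the momentum equation tested with eu *)
have energy i : (1 <= i)%N ->
    2 * mu * S i ^+ 2 + lam^-1 * X i ^+ 2 <= alpha / lam * (P i * X i).
  move=> i1; have [Vui Wi _ bi] := stepb i i1; have [Mpi _] := stepa i i1.
  rewrite strain_energy// /X L2norm_sqr.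
  have -> : form_b Om (eu i) (exi i) + lam^-1 * ip leb Om (exi i) (exi i) =
      alpha / lam * ip leb Om (fval (ep i)) (exi i).
    have := bi _ (Wexi i); have := eqb _ (Wexi i).
    rewrite (form_bBl mOm (VL2 _ Vui) (VL2 _ Vu) (WL2 _ (Wexi i))).
    rewrite /form_a2 /form_c.
    have LE := WL2 _ (Wexi i).
    rewrite (semi_innerBl ipS (WL2 _ Wi) (WL2 _ Wxi) LE).
    rewrite (semi_innerBl ipS (Mh_L2 Mpi).1 (Mh_L2 Mpn).1 LE).
    lra.
  rewrite ler_wpM2l//.
  exact: (ip_le mOm (Mh_L2 (Mep i i1)).1 (WL2 _ (Wexi i))).
have C0 : 0 < beta ^+ 2 / (2 * mu) by rewrite divr_gt0 ?exprn_gt0 ?mulr_gt0.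
have LsI : 0 < Ls < 1 by exact: contraction_factor_itv.
have contraction i : (1 <= i)%N -> X i <= Ls * X i.-1.
  move=> i1; have bXS : beta * X i <= 2 * mu * S i.
    exact: (inf_sup_strain mOm mu0 infsup VL2 (Veu i i1) (Wexi i) (momentum i i1)).
  have h1 := total_pressure_estimate mu0 l0 a0 b0 (P0 i) (X0 i) bXS (energy i i1).
  have h2 := pressure_estimate l0 a0 k0 c00 t0 CP0 (P0 i) (G0 i) (X0 i.-1)
    (PG i i1) (flow i i1).
  rewrite /Ls /contraction_factor; move: h1 h2.
  set A := _ + _ + 1; set B := _ + 1 => h1 h2.
  have B0 : 0 < B by rewrite addr_gt0// mulr_gt0.
  have A0 : 0 < A.
    rewrite addr_gt0// ltr_wpDl ?divr_gt0 ?mulr_gt0 ?exprn_gt0//.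
    by rewrite divr_ge0 ?mulr_ge0 ?exprn_ge0// ltW.
  rewrite mulrAC mul1r ler_pdivlMr ?mulr_gt0// mulrC -mulrA.
  by apply: le_trans h2; rewrite ler_pM2l.
have pressure i : (1 <= i)%N -> H1norm Om (ep i) <=
    (CP + 1) * (2 * (alpha / lam / dt) * CP / kp) * X i.-1.
  move=> i1; apply: (le_trans (pressure_H1_estimate CP0 (PG i i1))).
  rewrite -[leRHS]mulrA ler_wpM2l//.
  apply: (gradient_estimate ald0 k0 CP0 (P0 i) (G0 i) (X0 i.-1) (PG i i1)).
  apply: le_trans (flow i i1); rewrite lerDr mulr_ge0 ?sqr_ge0//.
  by rewrite divr_ge0 ?addr_ge0 ?divr_ge0 ?sqr_ge0// ltW.
have displacement i : (1 <= i)%N ->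
    vH1norm Om (eu i) <= d%:R / (2 * mu) * CK ^+ 2 * X i.
  move=> i1; have Le := VL2 _ (Veu i i1).
  have kornE : vH1norm Om (eu i) <= CK * S i by apply: kornCK; case: (Veu i i1).
  have h : 2 * mu * S i ^+ 2 <= d%:R * X i * (CK * S i).
    rewrite strain_energy//.
    apply: (le_trans (ler_norm _)).
    apply: (le_trans (form_b_le mOm Le (WL2 _ (Wexi i)))).
    by rewrite ler_wpM2l// mulr_ge0 ?ler0n ?sqrtr_ge0.
  have Sle : S i <= d%:R * X i * CK / (2 * mu).
    have := S0 i; rewrite le_eqVlt => /predU1P[<-|Si0].
      by rewrite !mulr_ge0// invr_ge0 ltW.
    rewrite ler_pdivlMr// -(ler_pM2r Si0) -[leRHS]mulrA.
    by rewrite (_ : S i * _ * _ = 2 * mu * S i ^+ 2)//; ring.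
  apply: (le_trans kornE).
  rewrite (_ : d%:R / _ * _ * _ = CK * (d%:R * X i * CK / (2 * mu))).
    by rewrite ler_pM2l.
  by field; rewrite gt_eqF.
have Xcvg : X @ \oo --> (0 : R) by exact: geometric_cvg0 LsI X0 contraction.
split=> //; split=> //.
- apply: (@squeeze_cvgr _ _ _ _ (cst 0) (fun i => d%:R / (2 * mu) * CK ^+ 2 * X i)).
  + by exists 1%N => // i /= i1; rewrite sqrtr_ge0 displacement.
  + exact: cvg_cst.
  + by rewrite -[X in _ --> X](mulr0 (d%:R / (2 * mu) * CK ^+ 2)); apply: cvgMr.
  (* the bound on ep at i refers to exi at i - 1, hence the shift *)
- rewrite -cvg_shiftS.
  apply: (@squeeze_cvgr _ _ _ _ (cst 0)
    (fun i => (CP + 1) * (2 * (alpha / lam / dt) * CP / kp) * X i)).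
  + by apply: nearW => i; rewrite sqrtr_ge0 (pressure i.+1).
  + exact: cvg_cst.
  + by rewrite -[X in _ --> X](mulr0 ((CP + 1) * (2 * (alpha / lam / dt) * CP / kp)));
      apply: cvgMr.
Qed.
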